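(* Let $G$ be a connected finite simple graph with vertex set $\{0,1,\dots,n\}$, let $\{k_1,k_2\}\in E(G)$, and fix a cell $C$ of the edge contraction subdivision $\mathcal{D}_{k_1,k_2}$ of $\nabla_G$. Let $P_C$ and $E_C$ be the ground sets of the two matroids associated with $C$ (the affine one and the graphic one, respectively). Then the function $f:2^{P_C}\to 2^{E_C}$ sending $X\subseteq P_C$ to the edge set of $G_X$ (the edge set of $G_{\bigcup_{\mathbf{x}\in X}\mathbf{x}}$) has the following properties for every $X\subseteq P_C$: (i) $f(X)$ is a basis if and only if $X$ is a basis; (ii) $f(X)$ is a circuit if and only if $X$ is a circuit; (iii) $f(X)$ is dependent if and only if $X$ is dependent; (iv) $\operatorname{rank}(f(X))=\operatorname{rank}(X)$.
   Context: For a connected finite simple graph $G$ with vertex set $\{0,1,\dots,n\}$ and edge set $E(G)$, let $\mathbf{e}_1,\dots,\mathbf{e}_n$ be the standard basis of $\mathbb{R}^n$ and $\mathbf{e}_0=\mathbf{0}$. Put $A_G=\{\mathbf{e}_i-\mathbf{e}_j : \{i,j\}\in E(G)\}$ (both orientations of every edge are included). The adjacency polytope is $\nabla_G=\operatorname{conv}(A_G)\subset\mathbb{R}^n$. Edge contraction subdivision: for an edge $\{k_1,k_2\}\in E(G)$, let $\omega:A_G\to\mathbb{Z}$ be given by $\omega(\mathbf{e}_i-\mathbf{e}_j)=0$ if $\{i,j\}=\{k_1,k_2\}$ and $\omega(\mathbf{e}_i-\mathbf{e}_j)=1$ otherwise. $\mathcal{D}_{k_1,k_2}$ is the regular subdivision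 of $\nabla_G$ (as a subdivision of the point configuration $A_G$) induced by $\omega$: its cells are the subsets $C\subseteq A_G$ with $\dim\operatorname{conv}(C)=n$ for which there exist $\boldsymbol\alpha\in\mathbb{R}^n$ and $h\in\mathbb{R}$ with $\langle\mathbf{x},\boldsymbol\alpha\rangle+\omega(\mathbf{x})=h$ for all $\mathbf{x}\in C$ and $\langle\mathbf{x},\boldsymbol\alpha\rangle+\omega(\mathbf{x})>h$ for all $\mathbf{x}\in A_G\setminus C$. Every cell contains both points $\pm(\mathbf{e}_{k_1}-\mathbf{e}_{k_2})$. For $Y\subseteq A_G$, $G_Y$ is the undirected simple graph with edge set $\{\{i,j\}:\mathbf{e}_i-\mathbf{e}_j\in Y\text{ or }\mathbf{e}_j-\mathbf{e}_i\in Y\}$ (no edges if $Y=\varnothing$). The affine matroid: its ground set is $P_C=\{\{\mathbf{c}\}:\mathbf{c}\in C,\ \mathbf{c}\neq\pm(\mathbf{e}_{k_1}-\mathbf{e}_{k_2})\}\cup\{\{\mathbf{e}_{k_1}-\mathbf{e}_{k_2},\,-(\mathbf{e}_{k_1}-\mathbf{e}_{k_2})\}\}$, so that its elements are subsets of $C$; a set $X\subseteq P_C$ is independent iff $\bigcup_{\mathbf{x}\in X}\mathbf{x}$ is an affinely independent set of points (the empty set is independent). The graphic matroid: its ground set is $E_C=E(G_C)$; a set of edges is independent iff it contains no cycle. A set is dependent if not independent; a basis is a maximal independent set; a circuit is a minimal dependent set; the rank of a set is the size of a largest independent subset of it. *)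

(* Defs.v *)
From HB Require Import structures.
From mathcomp Require Export all_boot all_order all_algebra.
From mathcomp Require Export finmap.
From mathcomp Require Export boolp reals.
Set Implicit Arguments.
Unset Strict Implicit.
Unset Printing Implicit Defensive.
Import Order.TTheory GRing.Theory Num.Theory.
Local Open Scope fset_scope.
Local Open Scope ring_scope.

Definition dotv (R : realType) (n : nat) (x y : 'rV[R]_n) : R :=
  \sum_(i < n) x ord0 i * y ord0 i.

Definition affinely_independent (R : realType) (n : nat)
    (S : {fset 'rV[R]_n}) : Prop :=
  forall c : 'rV[R]_n -> R,
    \sum_(x <- S) c x = 0 -> \sum_(x <- S) c x *: x = 0 ->
    forall x, x \in S -> c x = 0.

Definition conv (R : realType) (n : nat) (S : {fset 'rV[R]_n})
    (p : 'rV[R]_n) : Prop :=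
  exists c : 'rV[R]_n -> R,
    [/\ forall x, x \in S -> 0 <= c x, \sum_(x <- S) c x = 1
      & p = \sum_(x <- S) c x *: x].

(* The largest affinely independent families of points of K have d + 1
   members. For d a natural number this forces K to be nonempty. *)
Definition has_dim (R : realType) (n : nat) (K : 'rV[R]_n -> Prop)
    (d : nat) : Prop :=
  (exists T : {fset 'rV[R]_n},
     [/\ forall x, x \in T -> K x, affinely_independent T & #|` T| = d.+1])
  /\ (forall T : {fset 'rV[R]_n},
        (forall x, x \in T -> K x) -> affinely_independent T ->
        (#|` T| <= d.+1)%N).

Definition regular_cell (R : realType) (n : nat) (A : {fset 'rV[R]_n})
    (w : 'rV[R]_n -> int) (C : {fset 'rV[R]_n}) : Prop :=
  [/\ C `<=` A, has_dim (conv C) n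
    & exists (a : 'rV[R]_n) (h : R),
        (forall x, x \in C -> dotv x a + (w x)%:~R = h) /\
        (forall x, x \in A `\` C -> dotv x a + (w x)%:~R > h)].

(* e_0 = 0 and e_1, ..., e_n is the standard basis; [unlift ord0 i] is
   [None] for i = 0 and [Some] of the index i - 1 otherwise. *)
Definition vtx (R : realType) (n : nat) (i : 'I_n.+1) : 'rV[R]_n :=
  if unlift ord0 i is Some j then delta_mx ord0 j else 0.

Definition arc_pt (R : realType) (n : nat) (i j : 'I_n.+1) : 'rV[R]_n :=
  vtx R i - vtx R j.

(* A_G, the graph G on {0, ..., n} being given by its adjacency relation e. *)
Definition adj_points (R : realType) (n : nat) (e : rel 'I_n.+1) :
    {fset 'rV[R]_n} :=
  [fset arc_pt R p.1 p.2 | p in [pred p : 'I_n.+1 * 'I_n.+1 | e p.1 p.2]].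

(* For i != j, {i, j} = {k1, k2} exactly when e_i - e_j is one of the two
   points tested here. *)
Definition omega (R : realType) (n : nat) (k1 k2 : 'I_n.+1)
    (x : 'rV[R]_n) : int :=
  if (x == arc_pt R k1 k2) || (x == arc_pt R k2 k1) then 0 else 1.

Definition contraction_cell (R : realType) (n : nat) (e : rel 'I_n.+1)
    (k1 k2 : 'I_n.+1) (C : {fset 'rV[R]_n}) : Prop :=
  regular_cell (adj_points R e) (omega k1 k2) C.

(* The edge set of G_Y; an edge is a two-element set of vertices. *)
Definition edges_of (R : realType) (n : nat) (Y : {fset 'rV[R]_n}) :
    {fset {set 'I_n.+1}} :=
  [fset [set p.1; p.2]%SET | p in [pred p : 'I_n.+1 * 'I_n.+1 |
     (p.1 != p.2) && ((arc_pt R p.1 p.2 \in Y) || (arc_pt R p.2 p.1 \in Y))]].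

(* E is the ground set and I the independence predicate; every notion below
   applies to subsets of E only. *)

Definition independent_set (T : choiceType) (E : {fset T})
    (I : {fset T} -> Prop) (X : {fset T}) : Prop :=
  X `<=` E /\ I X.

Definition dependent_set (T : choiceType) (E : {fset T})
    (I : {fset T} -> Prop) (X : {fset T}) : Prop :=
  X `<=` E /\ ~ I X.

Definition basis_set (T : choiceType) (E : {fset T})
    (I : {fset T} -> Prop) (X : {fset T}) : Prop :=
  independent_set E I X /\
  (forall Y, independent_set E I Y -> X `<=` Y -> Y = X).

Definition circuit_set (T : choiceType) (E : {fset T})
    (I : {fset T} -> Prop) (X : {fset T}) : Prop :=
  dependent_set E I X /\
  (forall Y, dependent_set E I Y -> Y `<=` X -> Y = X).

Definition rank_set (T : choiceType) (E : {fset T})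
    (I : {fset T} -> Prop) (X : {fset T}) : nat :=
  \max_(Y <- fpowerset X | `[< independent_set E I Y >]) #|` Y|.

(* [fcover X] is the union of the members of X. *)
Definition affine_indep (R : realType) (n : nat)
    (X : {fset {fset 'rV[R]_n}}) : Prop :=
  affinely_independent (fcover X).

Definition affine_ground (R : realType) (n : nat) (k1 k2 : 'I_n.+1)
    (C : {fset 'rV[R]_n}) : {fset {fset 'rV[R]_n}} :=
  [fset [fset c] | c in [pred c in C |
     (c != arc_pt R k1 k2) && (c != - arc_pt R k1 k2)]]
  `|` [fset [fset arc_pt R k1 k2; - arc_pt R k1 k2]].

(* A cycle is a closed walk through at least three pairwise distinct
   vertices. *)
Definition graphic_indep (V : finType) (F : {fset {set V}}) : Prop :=
  ~ exists c : seq V,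
      (2 < size c)%N /\ ucycle (fun x y => [set x; y]%SET \in F) c.

Definition graphic_ground (R : realType) (n : nat) (C : {fset 'rV[R]_n}) :
    {fset {set 'I_n.+1}} := edges_of C.

Definition cell_map (R : realType) (n : nat) (X : {fset {fset 'rV[R]_n}}) :
    {fset {set 'I_n.+1}} := edges_of (fcover X).

(* Main.v *)
Require Import Defs.
From mathcomp Require Import lra.
Set Implicit Arguments.
Unset Strict Implicit.
Unset Printing Implicit Defensive.
Import Order.TTheory GRing.Theory Num.Theory.
Local Open Scope fset_scope.
Local Open Scope ring_scope.

(** A linear functional on R^n is the same thing as a potential g on the
vertices up to an additive constant, taking the value g i - g j at the point
e_i - e_j. Let h be the height of the supporting functional of a cell C, and
let p = e_k1 - e_k2. Comparing the heights of p and -p shows h <= 0. If h < 0,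
then C contains at most one of p and -p, and all its other points have value
h - 1 < 0. Either these values already put C in a hyperplane missing the
origin, or lowering the potential by one on a suitable set of vertices that
contains exactly one of k1 and k2 does so (one_sided_height_ge0); a
full-dimensional C allows neither (full_dim_no_hyperplane). Hence h = 0: C
contains p and -p, the potential takes equal values at k1 and k2, and it
increases by exactly one along every other arc of C
(contraction_cell_graded).

Such a grading has two consequences. First, {p, -p} is the only pair of
opposite points of C, so sending a member of the affine ground set to its pair
of endpoints is a bijection onto the edges of G_C, which induces the map f
(endpoints_inj, cell_map_endpoints). Secondly, evaluating the grading on a
linear dependence among points of C shows that the coefficients away from p
and -p sum to zero. The coefficients of p and -p can be redistributed without
changing the linear combination, so linear dependences of the edge vectors,
that is, cycles, are the same as affine dependences of the points. The two
directions are graphic_indep_affinely_independent, which isolates each edge of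
a forest by the indicator of one side of the cut it defines, and
affinely_independent_graphic_indep, which turns a cycle into an explicit
dependence.

Bases, circuits, dependent sets and ranks are then carried over by a general
fact on bijections of ground sets that preserve independence. *)

(** * Potentials as linear functionals on the points of an adjacency polytope *)

(** The normalization at vertex 0 accounts for e_0 being the zero vector. *)
Definition potential_covec (R : realType) (n : nat) (g : 'I_n.+1 -> R) :
    'rV[R]_n :=
  \row_j (g (lift ord0 j) - g ord0).

Lemma dotvBl (R : realType) n (x y a : 'rV[R]_n) :
  dotv (x - y) a = dotv x a - dotv y a.
Proof.
by rewrite /dotv -sumrB; apply: eq_bigr => i _; rewrite !mxE mulrBl.
Qed.

Lemma dotv_sum (R : realType) n (S : {fset 'rV[R]_n}) (c : 'rV[R]_n -> R) a :
  dotv (\sum_(x <- S) c x *: x) a = \sum_(x <- S) c x * dotv x a.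
Proof.
rewrite /dotv; under [RHS]eq_bigr do rewrite mulr_sumr.
rewrite exchange_big; apply: eq_bigr => i _.
rewrite summxE mulr_suml; apply: eq_bigr => x _.
by rewrite mxE mulrA.
Qed.

Lemma dotv_arc_pt (R : realType) n (i j : 'I_n.+1) (a : 'rV[R]_n) :
  dotv (arc_pt R i j) a = dotv (vtx R i) a - dotv (vtx R j) a.
Proof. exact: dotvBl. Qed.

Lemma dotv_potential (R : realType) n (g : 'I_n.+1 -> R) i j :
  dotv (arc_pt R i j) (potential_covec g) = g i - g j.
Proof.
have vtxE k : dotv (vtx R k) (potential_covec g) = g k - g ord0.
  rewrite /vtx /dotv; case: unliftP => [l ->|->] /=.
    rewrite (bigD1 l) //= big1 => [|m /negPf ml]; rewrite !mxE ?eqxx.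
      by rewrite mul1r addr0.
    by rewrite ml mul0r.
  by rewrite big1 ?subrr // => m _; rewrite mxE mul0r.
by rewrite dotv_arc_pt !vtxE; lra.
Qed.

Lemma arc_ptN (R : realType) n (i j : 'I_n.+1) : - arc_pt R i j = arc_pt R j i.
Proof. by rewrite /arc_pt opprB. Qed.

(** The indicator of the tail of an arc takes the value 1 on that arc, and on
another arc only if that arc has the same tail. *)
Lemma arc_pt_inj (R : realType) n (i j i' j' : 'I_n.+1) :
  i != j -> arc_pt R i j = arc_pt R i' j' -> i' = i /\ j' = j.
Proof.
move=> ij E.
have num (a b : bool) : 1 - 0 = a%:R - b%:R :> R -> a.
  by case: a b => -[] //=; lra.
have E' : arc_pt R j i = arc_pt R j' i' by rewrite -!(arc_ptN _ i) E arc_ptN.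
have D u v u' v' : u != v -> arc_pt R u v = arc_pt R u' v' -> u' = u.
  move=> uv /(congr1 (fun x => dotv x (potential_covec (fun w => (w == u)%:R)))).
  by rewrite !dotv_potential eqxx eq_sym (negPf uv) => /num/eqP.
by split; [apply: D E | apply: D E'; rewrite eq_sym].
Qed.

Lemma arc_pt_eq (R : realType) n (i j i' j' : 'I_n.+1) :
  i != j -> (arc_pt R i j == arc_pt R i' j') = (i == i') && (j == j').
Proof.
move=> ij; apply/eqP/andP => [/(arc_pt_inj ij)[-> ->] //|[/eqP-> /eqP->]//].
Qed.

Lemma set2_eq (T : finType) (i j u v : T) :
  ([set i; j]%SET == [set u; v]%SET) =
  (i == u) && (j == v) || (i == v) && (j == u).
Proof.
apply/eqP/orP => [E|[] /andP[/eqP-> /eqP->] //]; last by rewrite setUC.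
move/setP: E => E.
have := E i; have := E j; have := E u; have := E v.
rewrite !inE !eqxx !orbT /= [v == i]eq_sym [v == j]eq_sym [u == i]eq_sym.
rewrite [u == j]eq_sym.
by case: (i == u); case: (i == v); case: (j == u); case: (j == v) => //=; auto.
Qed.

(** * Full-dimensional sets lie in no hyperplane missing the origin *)

(** If x1, ..., x(n+1) are affinely independent, the square matrix with rows
(x_i, 1) is invertible, and the column (a, -b) lies in its kernel. *)
Lemma full_dim_no_hyperplane (R : realType) n (S : {fset 'rV[R]_n}) a b :
  has_dim (conv S) n -> (forall x, x \in S -> dotv x a = b) -> b = 0.
Proof.
case=> -[T [TS Tind cardT]] _ Sab.
have Tab t : t \in T -> dotv t a = b.
  move=> /TS[c [_ c1 ->]]; rewrite dotv_sum big_seq.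
  rewrite (eq_bigr (fun x => c x * b)) => [|x /Sab-> //].
  by rewrite -big_seq -mulr_suml c1 mul1r.
pose s : seq 'rV[R]_n := T.
pose M : 'M[R]_(size s, n + 1) :=
  \matrix_(i, j) row_mx (nth 0 s i) (const_mx 1 : 'rV_1) ord0 j.
have uniq_s : uniq s by exact: fset_uniq.
have sumT (V : nmodType) (F : 'rV[R]_n -> V) :
    \sum_(x <- T) F x = \sum_(i < size s) F (nth 0 s i).
  by rewrite (big_nth 0) big_mkord.
have Mfree : row_free M.
  apply: inj_row_free => v vM.
  have lt_index x : x \in s -> (index x s < size s)%N by rewrite index_mem.
  pose c x := if insub (index x s) is Some i then v ord0 i else 0.
  have cE (i : 'I_(size s)) : c (nth 0 s i) = v ord0 i.
    rewrite /c index_uniq // insubT // => lt_i.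
    by congr (v _ _); apply: val_inj.
  have c0 : forall x, x \in T -> c x = 0.
    apply: Tind.
      rewrite sumT; under eq_bigr do rewrite cE.
      move/matrixP: vM => /(_ ord0 (rshift n ord0)); rewrite !mxE => E.
      rewrite -[RHS]E.
      by apply: eq_bigr => i _; rewrite mxE row_mxEr mxE mulr1.
    rewrite sumT; under eq_bigr do rewrite cE.
    apply/rowP=> j; rewrite summxE mxE.
    move/matrixP: vM => /(_ ord0 (lshift 1 j)); rewrite !mxE => E.
      rewrite -[RHS]E.
    by apply: eq_bigr => i _; rewrite mxE [in RHS]mxE row_mxEl.
  by apply/rowP=> i; rewrite mxE -cE c0 // mem_nth.
have Mfull : row_full M.
  by move: Mfree; rewrite /row_free /row_full => /eqP->; rewrite addn1 -cardT.
have Mw : M *m col_mx a^T (const_mx (- b)) = M *m 0.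
  apply/colP=> i; rewrite mulmx0 !mxE big_split_ord big_ord1 /=.
  rewrite mxE row_mxEr col_mxEd !mxE mul1r.
  rewrite -(Tab (nth 0 s i)) ?mem_nth // /dotv.
  under eq_bigr do rewrite mxE row_mxEl col_mxEu mxE.
  exact: subrr.
move/(row_full_inj Mfull)/matrixP: Mw => /(_ (rshift n ord0) ord0).
by rewrite col_mxEd !mxE => /eqP; rewrite oppr_eq0 => /eqP.
Qed.

(** * The cells of the edge contraction subdivision *)

(** The normal form of the functional supporting a cell: its height is 0, so it
takes the value -1 on the points lifted to height 1 and 0 on the others. *)
Definition graded_by (R : realType) n (k1 k2 : 'I_n.+1) (C : {fset 'rV[R]_n})
    (g : 'I_n.+1 -> R) : Prop :=
  [/\ k1 != k2,
      forall x, x \in C -> exists i j, i != j /\ x = arc_pt R i j,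
      g k1 = g k2
    & forall i j, arc_pt R i j \in C ->
        [set i; j]%SET != [set k1; k2]%SET -> g j = g i + 1].

(** If h were negative, then -1 < h / (1 - h) < 0, so that g k1 - g k2 = h would
not be an integer multiple of h - 1. The set S of vertices whose potential
differs from that of k1 by such a multiple therefore contains k1 but not k2,
while every arc of C other than (k1, k2) has both ends in S or both outside.
Subtracting 1 from g on S gives all points of C the value h - 1. *)
Lemma one_sided_height_ge0 (R : realType) n (k1 k2 : 'I_n.+1)
    (C : {fset 'rV[R]_n}) (g : 'I_n.+1 -> R) h :
    has_dim (conv C) n ->
    (forall x, x \in C -> exists i j, x = arc_pt R i j) ->
    g k1 - g k2 = h ->
    (forall i j, arc_pt R i j \in C -> (i, j) != (k1, k2) ->
       g i - g j = h - 1) ->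
  0 <= h.
Proof.
move=> dimC arcC gk gC; rewrite leNgt; apply/negP => h_lt0.
pose S u := `[< exists z : int, g k1 - g u = z%:~R * (h - 1) >].
have Sk1 : S k1 by apply/asboolP; exists 0; rewrite mul0r subrr.
have SNk2 : ~~ S k2.
  apply/asboolPn => -[z]; rewrite gk => hz.
  have [z_le0|z_gt0] := lerP z 0.
    have : 0 <= z%:~R * (h - 1) by rewrite mulr_le0 ?lerz0 //; lra.
    by lra.
  have : (1 : R) <= z%:~R by rewrite -[1]/(1%:~R) ler_int.
  by move: hz; nra.
have Sarc i j : arc_pt R i j \in C -> (i, j) != (k1, k2) -> S i = S j.
  move=> Cij nk; have gij := gC i j Cij nk.
  apply/asboolP/asboolP => -[z Ez].
    by exists (z + 1); rewrite intrD mulrDl -Ez mul1r -gij; lra.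
  by exists (z - 1); rewrite intrB mulrBl -Ez mul1r -gij; lra.
pose g' u := g u - (S u)%:R.
have : h - 1 = 0.
  apply: (@full_dim_no_hyperplane R n C (potential_covec g')) => // x Cx.
  have [i [j xE]] := arcC x Cx; rewrite xE in Cx *.
  rewrite dotv_potential /g'; have [[-> ->]|nk] := (i, j) =P (k1, k2).
    by rewrite Sk1 (negPf SNk2) /=; lra.
  by rewrite (Sarc i j) ?gC //; [rewrite -(gC i j) //; [lra|]|]; apply/eqP.
by lra.
Qed.

Lemma contraction_cell_graded (R : realType) n (e : rel 'I_n.+1)
    (e_sym : symmetric e) (e_irr : irreflexive e) (k1 k2 : 'I_n.+1)
    (e_k : e k1 k2) (C : {fset 'rV[R]_n}) :
  contraction_cell e k1 k2 C ->
  [/\ arc_pt R k1 k2 \in C, arc_pt R k2 k1 \in C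
    & exists g, graded_by k1 k2 C g].
Proof.
case=> CA dimC [a [h [onC offC]]].
pose g u := dotv (vtx R u) a.
have ne u v : e u v -> u != v.
  by apply: contraTneq => ->; rewrite e_irr.
have k12 := ne _ _ e_k.
have arcC x : x \in C -> exists i j, i != j /\ x = arc_pt R i j.
  move=> /(fsubsetP CA) /imfsetP[[i j] /= eij ->].
  by exists i, j; split=> //; apply: ne.
have Ap : arc_pt R k1 k2 \in adj_points R e.
  by apply/imfsetP; exists (k1, k2).
have Aq : arc_pt R k2 k1 \in adj_points R e.
  by apply/imfsetP; exists (k2, k1) => //=; rewrite unfold_in /= e_sym.
have w0 : omega k1 k2 (arc_pt R k1 k2) = 0 by rewrite /omega eqxx.
have w0' : omega k1 k2 (arc_pt R k2 k1) = 0 by rewrite /omega eqxx orbT.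
have gC i j : arc_pt R i j \in C -> [set i; j]%SET != [set k1; k2]%SET ->
    g i - g j = h - 1.
  move=> Cij; rewrite set2_eq => nk; rewrite -(onC _ Cij) dotv_arc_pt /omega.
  have ij : i != j.
    have [u [v [uv E]]] := arcC _ Cij.
    by have [-> ->] := arc_pt_inj uv (esym E).
  by rewrite !arc_pt_eq // (negPf nk) /= -!/(g _); lra.
have hp : if arc_pt R k1 k2 \in C then g k1 - g k2 = h else h < g k1 - g k2.
  case: ifPn => Cp; first by rewrite -(onC _ Cp) dotv_arc_pt w0 addr0.
  by move: (offC (arc_pt R k1 k2)); rewrite in_fsetD Cp Ap dotv_arc_pt w0 addr0;
     apply.
have hq : if arc_pt R k2 k1 \in C then g k2 - g k1 = h else h < g k2 - g k1.
  case: ifPn => Cq; first by rewrite -(onC _ Cq) dotv_arc_pt w0' addr0.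
  by move: (offC (arc_pt R k2 k1)); rewrite in_fsetD Cq Aq dotv_arc_pt w0' addr0;
     apply.
have arcC' x : x \in C -> exists i j, x = arc_pt R i j.
  by move=> /arcC[i [j [_ ->]]]; exists i, j.
(* If p or -p is missing from C, its strict inequality makes h negative. *)
case: ifPn hp => Cp hp; case: ifPn hq => Cq hq.
- split=> //; exists g; split=> //; first lra.
  by move=> i j Cij nk; have := gC i j Cij nk; lra.
- suff : 0 <= h by lra.
  apply: (one_sided_height_ge0 dimC arcC' hp) => i j Cij nk; apply: gC => //.
  rewrite set2_eq -xpair_eqE (negPf nk) /=.
  by apply: contraNN Cq => /andP[/eqP<- /eqP<-].
- suff : 0 <= h by lra.
  apply: (one_sided_height_ge0 dimC arcC' hq) => i j Cij nk; apply: gC => //.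
  rewrite set2_eq orbC -xpair_eqE (negPf nk) /=.
  by apply: contraNN Cp => /andP[/eqP<- /eqP<-].
- suff : h - 1 = 0 by lra.
  apply: (@full_dim_no_hyperplane R n C a) => // x Cx.
  have [i [j xE]] := arcC' x Cx; rewrite xE in Cx *.
  rewrite dotv_arc_pt; apply: gC => //; rewrite set2_eq; apply/negP.
  by case/orP=> /andP[/eqP ei /eqP ej]; move: Cx; rewrite ei ej ?(negPf Cp) ?(negPf Cq).
Qed.

(** * Cycles and affine dependences *)

Lemma edges_ofP (R : realType) n (Y : {fset 'rV[R]_n}) (s : {set 'I_n.+1}) :
  reflect (exists i j, [/\ i != j, arc_pt R i j \in Y & s = [set i; j]%SET])
    (s \in edges_of Y).
Proof.
apply: (iffP (imfsetP _ _ _ _)) => [[[i j] /= /andP[ij /orP[] Y_ij] ->]|].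
- by exists i, j.
- by exists j, i; rewrite eq_sym ij setUC.
by case=> i [j [ij Y_ij ->]]; exists (i, j) => //=; rewrite unfold_in /= ij Y_ij.
Qed.

(** In a graph without cycles every edge is a bridge: S is the component of i
after deletion of the edge, and a simple path from i to j avoiding the edge
would close up with it to a cycle. *)
Lemma acyclic_bridge (V : finType) (F : {fset {set V}}) (i j : V) :
  graphic_indep F -> i != j -> [set i; j]%SET \in F ->
  exists S : pred V, [/\ S i, ~~ S j
    & forall u v, [set u; v]%SET \in F -> [set u; v]%SET != [set i; j]%SET ->
        S u = S v].
Proof.
move=> acyF ij Fij.
pose r u v := ([set u; v]%SET \in F) && ([set u; v]%SET != [set i; j]%SET).
have r_sym : symmetric r by move=> u v; rewrite /r setUC.
exists (connect r i); split; first exact: connect0.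
  apply/negP=> /connectP[p0 r_p0 j_last]; apply: acyF.
  case: (shortenP r_p0) j_last => p r_p uniq_p _ j_last.
  (* A path with a single step would be the deleted edge itself. *)
  exists (i :: p); split.
    case: p r_p {uniq_p} j_last => [_ /= ji|x [|y p]] //=.
      by rewrite ji eqxx in ij.
    by move=> + jx; rewrite -jx /r eqxx andbF.
  rewrite /ucycle uniq_p andbT /= rcons_path -j_last setUC Fij andbT.
  by apply: sub_path r_p => u v /andP[].
by move=> u v Fuv nij; apply: same_connect1r => //; [exact: sym_connect_sym|apply/andP].
Qed.

(** The indicator of one side of the cut defined by a bridge vanishes on all
points except the two orientations of the bridge, where it is 1 and -1. *)
Lemma acyclic_coef (R : realType) n (Y : {fset 'rV[R]_n}) (c : 'rV[R]_n -> R)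
    (i j : 'I_n.+1) :
    (forall x, x \in Y -> exists u v, u != v /\ x = arc_pt R u v) ->
    graphic_indep (edges_of Y) -> \sum_(x <- Y) c x *: x = 0 ->
    i != j -> arc_pt R i j \in Y ->
  c (arc_pt R i j) = if arc_pt R j i \in Y then c (arc_pt R j i) else 0.
Proof.
move=> arcY acyY c0 ij Yij.
have [|S [Si SNj Sedge]] := @acyclic_bridge _ _ i j acyY ij.
  by apply/edges_ofP; exists i, j.
pose a := potential_covec (fun u => (S u)%:R : R).
have a0 x : x \in Y -> x != arc_pt R i j -> x != arc_pt R j i -> dotv x a = 0.
  move=> Yx; have [u [v [uv xE]]] := arcY x Yx; rewrite xE in Yx *.
  rewrite !arc_pt_eq // => nij nji; rewrite dotv_potential (Sedge u v) ?subrr //.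
    by apply/edges_ofP; exists u, v.
  by rewrite set2_eq negb_or nij nji.
have aij : dotv (arc_pt R i j) a = 1.
  by rewrite dotv_potential Si (negPf SNj) subr0.
have aji : dotv (arc_pt R j i) a = -1.
  by rewrite dotv_potential Si (negPf SNj) sub0r.
have : \sum_(x <- Y) c x * dotv x a = 0.
  by rewrite -dotv_sum c0 /dotv big1 // => k _; rewrite mxE mul0r.
rewrite (big_fsetD1 _ Yij) /= aij mulr1.
have ji_ij : arc_pt R j i != arc_pt R i j.
  by rewrite arc_pt_eq 1?eq_sym // negb_and ij.
case: ifPn => [Yji|YNji]; last first.
  rewrite big1_seq ?addr0 // => x /=; rewrite in_fsetD1 => /andP[xij Yx].
  by rewrite a0 ?mulr0 //; apply: contraNneq YNji => <-.
rewrite (big_fsetD1 (arc_pt R j i)) ?in_fsetD1 ?ji_ij //= aji mulrN1.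
rewrite big1_seq => [|x /=].
  by rewrite addr0 => /eqP; rewrite subr_eq0 => /eqP.
by rewrite !in_fsetD1 => /and3P[xji xij Yx]; rewrite a0 ?mulr0.
Qed.

(** The potential cannot increase by one along both orientations. *)
Lemma graded_opposite (R : realType) n (k1 k2 : 'I_n.+1) (C : {fset 'rV[R]_n})
    (g : 'I_n.+1 -> R) i j :
  graded_by k1 k2 C g -> arc_pt R i j \in C -> arc_pt R j i \in C ->
  [set i; j]%SET = [set k1; k2]%SET.
Proof.
case=> _ _ _ gC Cij Cji; apply/eqP/negPn/negP => nk.
have gij := gC i j Cij nk; rewrite setUC in nk.
by have gji := gC j i Cji nk; move: gij gji; lra.
Qed.

(** In a forest a linear dependence has opposite points cancel each other. Only
p and -p can be opposite in C, so it reduces to equal coefficients on p and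
-p, and the vanishing of the sum of the coefficients forces these to be 0. *)
Lemma graphic_indep_affinely_independent (R : realType) n (k1 k2 : 'I_n.+1)
    (C Y : {fset 'rV[R]_n}) (g : 'I_n.+1 -> R) :
    graded_by k1 k2 C g -> Y `<=` C ->
    (arc_pt R k1 k2 \in Y) = (arc_pt R k2 k1 \in Y) ->
  graphic_indep (edges_of Y) -> affinely_independent Y.
Proof.
move=> gC /fsubsetP YC Yk acyY c c_sum0 c0.
have [k12 arcC _ _] := gC.
have arcY x : x \in Y -> exists u v, u != v /\ x = arc_pt R u v.
  by move/YC/arcC.
have coef i j : i != j -> arc_pt R i j \in Y -> _ :=
  acyclic_coef arcY acyY c0.
have c_ord i j : i != j -> arc_pt R i j \in Y ->
    [set i; j]%SET != [set k1; k2]%SET -> c (arc_pt R i j) = 0.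
  move=> ij Yij nk; rewrite coef //; case: ifPn => // Yji.
  by rewrite (graded_opposite gC (YC _ Yij) (YC _ Yji)) eqxx in nk.
have c_k : arc_pt R k1 k2 \in Y ->
    c (arc_pt R k1 k2) = 0 /\ c (arc_pt R k2 k1) = 0.
  move=> Yp; have Yq := Yp; rewrite Yk in Yq.
  have pq : c (arc_pt R k1 k2) = c (arc_pt R k2 k1) by rewrite coef // Yq.
  have : c (arc_pt R k1 k2) + c (arc_pt R k2 k1) = 0.
    rewrite -[RHS]c_sum0 (big_fsetD1 _ Yp) /=; congr (_ + _).
    rewrite (big_fsetD1 (arc_pt R k2 k1)) /=; last first.
      by rewrite in_fsetD1 Yq arc_pt_eq 1?eq_sym // negb_and k12.
    rewrite big1_seq ?addr0 // => x /=; rewrite !in_fsetD1 => /and3P[xq xp Yx].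
    have [i [j [ij xE]]] := arcY x Yx; rewrite xE in xq xp Yx *.
    rewrite c_ord // set2_eq negb_or; rewrite !arc_pt_eq // in xp xq.
    by rewrite xp xq.
  by move: pq; clear; lra.
move=> x Yx; have [i [j [ij xE]]] := arcY x Yx; rewrite xE in Yx *.
have [|nk] := eqVneq [set i; j]%SET [set k1; k2]%SET; last exact: c_ord.
move/eqP; rewrite set2_eq => /orP[] /andP[/eqP ei /eqP ej]; rewrite ei ej in Yx *.
  by have [] := c_k Yx.
by rewrite -Yk in Yx; have [] := c_k Yx.
Qed.

Lemma sum_next (V : zmodType) (T : eqType) (s : seq T) (F : T -> V) :
  uniq s -> \sum_(u <- s) (F u - F (next s u)) = 0.
Proof.
move=> uniq_s; rewrite sumrB -(big_map (next s) xpredT F).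
suff perm_next : perm_eq s [seq next s u | u <- s].
  by rewrite -(perm_big _ perm_next) subrr.
apply: uniq_perm => //.
  by rewrite map_inj_uniq //; apply: can_inj (prev_next uniq_s).
move=> u; apply/idP/mapP => [su|[v sv ->]]; last by rewrite mem_next.
by exists (prev s u); rewrite ?mem_prev ?next_prev.
Qed.

Lemma sum_pick (R : realType) n (Y : {fset 'rV[R]_n}) (y : 'rV[R]_n)
    (V : zmodType) (F : 'rV[R]_n -> V) :
  \sum_(x <- Y) (if x == y then F x else 0) = if y \in Y then F y else 0.
Proof.
case: ifPn => [Yy|YNy].
  rewrite (big_fsetD1 _ Yy) /= eqxx big1_seq ?addr0 // => x /=.
  by rewrite in_fsetD1 => /andP[/negPf->].
by rewrite big1_seq // => x /= Yx; case: eqP => // xy; rewrite -xy Yx in YNy.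
Qed.

(** Going around a cycle, the vectors e_u - e_v of its steps u -> v sum to zero.
Each step is written with the points of Y: with coefficient 1 or -1 on the
orientation present in Y, and with 1/2 and -1/2 on p and -p, or the reverse,
for the contracted edge. The coefficients used for a step then sum to
g v - g u, so around the cycle they sum to zero as well. *)
Lemma affinely_independent_graphic_indep (R : realType) n (k1 k2 : 'I_n.+1)
    (C Y : {fset 'rV[R]_n}) (g : 'I_n.+1 -> R) :
    graded_by k1 k2 C g -> Y `<=` C ->
    (arc_pt R k1 k2 \in Y) = (arc_pt R k2 k1 \in Y) ->
  affinely_independent Y -> graphic_indep (edges_of Y).
Proof.
move=> gC /fsubsetP YC Yk affY [s [s_gt2 /andP[cyc_s uniq_s]]].
have [k12 arcC gk g_arc] := gC.
pose N := next s.
pose w (x : 'rV[R]_n) : R :=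
  if (x == arc_pt R k1 k2) || (x == arc_pt R k2 k1) then 2^-1 else 1.
pose c x := \sum_(u <- s) ((if x == arc_pt R u (N u) then w x else 0)
                           - (if x == arc_pt R (N u) u then w x else 0)).
have edgeN u : u \in s -> u != N u /\
    (arc_pt R u (N u) \in Y \/ arc_pt R (N u) u \in Y).
  move=> su; have /edges_ofP[i [j [ij Yij /eqP]]] := next_cycle cyc_s su.
  rewrite set2_eq -/(N u) => /orP[] /andP[/eqP-> /eqP->].
    by split; auto.
  by rewrite eq_sym; split; auto.
(* The weights of the orientations of an edge that lie in Y sum to 1, and their
   difference is the increase of the potential. *)
have weights u v : u != v -> arc_pt R u v \in Y ->
    [/\ (if arc_pt R v u \in Y then w (arc_pt R v u) else 0)
          = 1 - w (arc_pt R u v)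
      & w (arc_pt R u v) - (1 - w (arc_pt R u v)) = g v - g u].
  have -> : w (arc_pt R v u) = w (arc_pt R u v).
    by rewrite /w -(arc_ptN R u v) !eqr_oppLR !arc_ptN orbC.
  move=> uv Yuv; rewrite /w !arc_pt_eq //.
  have [|nk] := boolP ((u == k1) && (v == k2) || (u == k2) && (v == k1)).
    case/orP=> /andP[/eqP eu /eqP ev]; rewrite eu ev in Yuv *.
      by rewrite -Yk Yuv gk; split; lra.
    by rewrite Yk Yuv gk; split; lra.
  rewrite -set2_eq in nk; case: ifPn => [Yvu|_].
    by rewrite (graded_opposite gC (YC _ Yuv) (YC _ Yvu)) eqxx in nk.
  by have gv := g_arc _ _ (YC _ Yuv) nk; split; lra.
have c_sum0 : \sum_(x <- Y) c x = 0.
  rewrite exchange_big /=; under eq_bigr do rewrite sumrB !sum_pick.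
  rewrite -[RHS](sum_next (fun u => - g u) uniq_s) big_seq [RHS]big_seq.
  apply: eq_bigr => u su; rewrite -/(N u).
  have [uN [YuN|YNu]] := edgeN u su; [|rewrite eq_sym in uN].
    by have [-> wg] := weights _ _ uN YuN; rewrite YuN wg; lra.
  by have [-> wg] := weights _ _ uN YNu; rewrite YNu; move: wg; lra.
have c0 : \sum_(x <- Y) c x *: x = 0.
  have -> : \sum_(x <- Y) c x *: x = \sum_(u <- s)
      \sum_(x <- Y) ((if x == arc_pt R u (N u) then w x *: x else 0)
                    - (if x == arc_pt R (N u) u then w x *: x else 0)).
    rewrite exchange_big; apply: eq_bigr => x _; rewrite /c scaler_suml.
    apply: eq_bigr => u _; rewrite scalerBl.
    by case: ifP; case: ifP; rewrite ?scale0r.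
  under eq_bigr do rewrite sumrB !sum_pick.
  rewrite -[RHS](sum_next (fun u => vtx R u) uniq_s) big_seq [RHS]big_seq.
  apply: eq_bigr => u su; rewrite -/(N u) -/(arc_pt R u (N u)).
  have scale_if (b : bool) (z : R) (x : 'rV[R]_n) :
      (if b then z *: x else 0) = (if b then z else 0) *: x.
    by case: b; rewrite ?scale0r.
  rewrite !scale_if -[X in _ - _ *: X](arc_ptN R u) scalerN opprK -scalerDl.
  rewrite -[RHS]scale1r; congr (_ *: _).
  have [uN [YuN|YNu]] := edgeN u su; [|rewrite eq_sym in uN].
    by have [-> _] := weights _ _ uN YuN; rewrite YuN; lra.
  by have [-> _] := weights _ _ uN YNu; rewrite YNu; lra.
(* As the cycle has more than two vertices, it has a step u -> v that it does
   not traverse backwards, so no cancellation affects its coefficient. *)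
have [x0 [x1 [sx0 Nx1 sN]]] : exists u v, [/\ u \in s, N u = v & N v != u].
  rewrite /N; case: (s) s_gt2 uniq_s => [|u [|v [|z q]]] //= _ /and3P[+ + _].
  rewrite !inE !negb_or => /and3P[uv uz _] _.
  by exists u, v; rewrite eqxx [v == u]eq_sym (negPf uv) inE !eqxx eq_sym.
have w_neq0 x : w x != 0.
  by rewrite /w; case: ifP => _; rewrite ?invr_eq0 ?pnatr_eq0 ?oner_eq0.
have [] := edgeN x0 sx0; rewrite Nx1 => x01 Y01.
have arc_next t : (arc_pt R x0 x1 == arc_pt R t (N t)) = (t == x0).
  rewrite arc_pt_eq // [x0 == t]eq_sym -Nx1.
  by case: eqP => //= ->; rewrite eqxx.
have arc_prev t : (arc_pt R x0 x1 == arc_pt R (N t) t) = false.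
  rewrite arc_pt_eq //; apply: contraNF sN => /andP[/eqP E /eqP->].
  by rewrite E.
have opp_eq i j : (arc_pt R x1 x0 == arc_pt R i j) = (arc_pt R x0 x1 == arc_pt R j i).
  by rewrite -(arc_ptN R x0) -(arc_ptN R j) eqr_opp.
have at_x0 (z : R) : \sum_(u <- s) (if u == x0 then z else 0) = z.
  rewrite (bigD1_seq x0) //= eqxx big1 ?addr0 // => u /negPf-> //.
case: Y01 => /affY - /(_ c c_sum0 c0) /eqP.
  rewrite /c; under eq_bigr do rewrite arc_next arc_prev subr0.
  by rewrite at_x0 (negPf (w_neq0 _)).
rewrite /c; under eq_bigr do rewrite !opp_eq arc_next arc_prev sub0r.
by rewrite sumrN at_x0 oppr_eq0 (negPf (w_neq0 _)).
Qed.

(** * Transport of independence along a bijection of ground sets *)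

Section Transport.
Variables (T U : choiceType) (P : {fset T}) (phi : T -> U).
Variables (I : {fset T} -> Prop) (J : {fset U} -> Prop).
Hypothesis phi_inj : {in P &, injective phi}.
Hypothesis indepE : forall X, X `<=` P -> J (phi @` X) <-> I X.

Lemma imfset_subset X : X `<=` P -> phi @` X `<=` phi @` P.
Proof. by move=> /fsubsetP XP; apply: subset_imfset. Qed.

Lemma imfset_subset_inj X Y : X `<=` P -> Y `<=` P ->
  (phi @` X `<=` phi @` Y) = (X `<=` Y).
Proof.
move=> /fsubsetP XP /fsubsetP YP; apply/fsubsetP/fsubsetP => sXY x.
  move=> Xx; have /imfsetP[y /= Yy] := sXY _ (in_imfset imfset_key phi Xx).
  by move/phi_inj => -> //; [apply: XP | apply: YP].
by move=> /imfsetP[y /= /sXY Yy ->]; apply: in_imfset.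
Qed.

Lemma imfset_eq_inj X Y : X `<=` P -> Y `<=` P -> phi @` X = phi @` Y -> X = Y.
Proof.
move=> XP YP E; apply/eqP.
by rewrite eqEfsubset -(imfset_subset_inj XP YP) -(imfset_subset_inj YP XP) E fsubset_refl.
Qed.

Lemma imfset_preimage Z : Z `<=` phi @` P ->
  exists2 Y, Y `<=` P & Z = phi @` Y.
Proof.
move=> /fsubsetP ZP; exists [fset x in P | phi x \in Z].
  by apply/fsubsetP=> x; rewrite !inE => /andP[].
apply/fsetP=> z; apply/idP/imfsetP => [Zz|[x /=]]; last first.
  by rewrite !inE => /andP[_ +] ->.
have /imfsetP[x /= Px zx] := ZP z Zz.
by exists x; rewrite // !inE Px -zx Zz.
Qed.

Lemma independent_set_imfset X : X `<=` P ->
  independent_set (phi @` P) J (phi @` X) <-> independent_set P I X.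
Proof.
move=> XP; split=> -[_ /(indepE XP)]; split=> //; exact: imfset_subset.
Qed.

Lemma dependent_set_imfset X : X `<=` P ->
  dependent_set (phi @` P) J (phi @` X) <-> dependent_set P I X.
Proof.
move=> XP; split=> -[_ dX]; split=> //; [|exact: imfset_subset|];
  by move/(indepE XP)/dX.
Qed.

Lemma basis_set_imfset X : X `<=` P ->
  basis_set (phi @` P) J (phi @` X) <-> basis_set P I X.
Proof.
move=> XP; split=> -[/(independent_set_imfset XP) iX maxX]; split=> // Y iY sXY.
  have YP := iY.1; apply: imfset_eq_inj => //.
  by apply: maxX; [apply/independent_set_imfset | rewrite imfset_subset_inj].
have [Y' Y'P YE] := imfset_preimage iY.1; rewrite YE in iY sXY *.
rewrite imfset_subset_inj // in sXY.
by rewrite (maxX Y') //; apply/independent_set_imfset.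
Qed.

Lemma circuit_set_imfset X : X `<=` P ->
  circuit_set (phi @` P) J (phi @` X) <-> circuit_set P I X.
Proof.
move=> XP; split=> -[/(dependent_set_imfset XP) dX minX]; split=> // Y dY sYX.
  have YP := dY.1; apply: imfset_eq_inj => //.
  by apply: minX; [apply/dependent_set_imfset | rewrite imfset_subset_inj].
have [Y' Y'P YE] := imfset_preimage dY.1; rewrite YE in dY sYX *.
rewrite imfset_subset_inj // in sYX.
by rewrite (minX Y') //; apply/dependent_set_imfset.
Qed.

Lemma rank_set_imfset X : X `<=` P ->
  rank_set (phi @` P) J (phi @` X) = rank_set P I X.
Proof.
move=> XP; have card_phi Y : Y `<=` P -> #|` phi @` Y| = #|` Y|.
  move=> /fsubsetP YP; rewrite card_in_imfset //=.
  by move=> x y /YP Px /YP Py; apply: phi_inj.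
apply/eqP; rewrite eqn_leq /rank_set; apply/andP; split; apply/bigmax_leqP_seq => Y.
  rewrite fpowersetE => sYX /asboolP iY.
  have [Y' Y'P YE] := imfset_preimage iY.1; rewrite YE in iY sYX *.
  rewrite card_phi // (@leq_bigmax_seq _ _ _ (fun Z : {fset T} => #|` Z|)) //.
    by rewrite fpowersetE -imfset_subset_inj.
  by apply/asboolP/independent_set_imfset.
rewrite fpowersetE => sYX /asboolP iY; have YP := iY.1.
rewrite -card_phi // (@leq_bigmax_seq _ _ _ (fun Z : {fset U} => #|` Z|)) //.
  by rewrite fpowersetE imfset_subset_inj.
by apply/asboolP/independent_set_imfset.
Qed.

End Transport.

(** * The bijection between blocks and edges *)

(** On a member of the affine ground set this is the edge that the block
represents; the block {p, -p} is sent to the single edge {k1, k2}. *)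
Definition endpoints (R : realType) n (x : {fset 'rV[R]_n}) : {set 'I_n.+1} :=
  [set i | [exists j, (arc_pt R i j \in x) || (arc_pt R j i \in x)]]%SET.

Section Blocks.
Variables (R : realType) (n : nat) (k1 k2 : 'I_n.+1) (C : {fset 'rV[R]_n}).
Variable g : 'I_n.+1 -> R.
Hypotheses (Cp : arc_pt R k1 k2 \in C) (Cq : arc_pt R k2 k1 \in C).
Hypothesis gC : graded_by k1 k2 C g.

Let P := affine_ground k1 k2 C.
Let K := [fset arc_pt R k1 k2; - arc_pt R k1 k2].

(** Recovering a block from one of its arcs treats the singletons and {p, -p}
uniformly. *)
Lemma blockP x : x \in P ->
  exists i j, [/\ i != j, arc_pt R i j \in C, arc_pt R i j \in x
    & x = if [set i; j]%SET == [set k1; k2]%SET then K else [fset arc_pt R i j]].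
Proof.
have [k12 arcC _ _] := gC.
rewrite in_fsetU in_fset1 => /orP[/imfsetP[c /= + ->]|/eqP->]; last first.
  by exists k1, k2; rewrite eqxx in_fset2 eqxx.
rewrite inE /= arc_ptN => /and3P[Cc cp cq]; have [i [j [ij cE]]] := arcC c Cc.
exists i, j; rewrite -cE in_fset1 eqxx Cc; split=> //.
rewrite cE !arc_pt_eq // in cp cq.
by rewrite set2_eq (negPf cp) (negPf cq).
Qed.

Lemma mem_block x i j : x \in P -> i != j -> arc_pt R i j \in x ->
  x = if [set i; j]%SET == [set k1; k2]%SET then K else [fset arc_pt R i j].
Proof.
have [k12 _ _ _] := gC.
move=> /blockP[u [v [uv _ _ ->]]] ij; case: ifP => uvk.
  rewrite in_fset2 arc_ptN !arc_pt_eq // => /orP[] /andP[/eqP-> /eqP->].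
    by rewrite eqxx.
  by rewrite [[set k2; k1]%SET]setUC eqxx.
by rewrite in_fset1 arc_pt_eq // => /andP[/eqP-> /eqP->]; rewrite uvk.
Qed.

Lemma block_sub x : x \in P -> x `<=` C.
Proof.
move=> /blockP[i [j [_ Cij _ ->]]]; case: ifP => _; apply/fsubsetP => y.
  by rewrite in_fset2 arc_ptN => /orP[] /eqP->.
by rewrite in_fset1 => /eqP->.
Qed.

Lemma endpoints_block x i j : x \in P -> i != j -> arc_pt R i j \in x ->
  endpoints x = [set i; j]%SET.
Proof.
have [k12 _ _ _] := gC; have k21 : k2 != k1 by rewrite eq_sym.
move=> Px ij xij; apply/setP=> u; rewrite !inE; apply/existsP/orP => [[v]|].
  have uvP s t : arc_pt R s t \in x -> (s == i) && (t == j) || (s == j) && (t == i).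
    rewrite (mem_block Px ij xij); case: ifPn => [|_]; last first.
      by rewrite in_fset1 eq_sym arc_pt_eq // => /andP[/eqP-> /eqP->]; rewrite !eqxx.
    rewrite set2_eq in_fset2 arc_ptN ![arc_pt _ s t == _]eq_sym.
    rewrite !arc_pt_eq // => /orP[] /andP[/eqP-> /eqP->];
      by case/orP=> /andP[/eqP-> /eqP->]; rewrite !eqxx ?orbT.
  by case/orP=> /uvP/orP[] /andP[] *; auto.
by case=> /eqP->; [exists j | exists i]; rewrite xij ?orbT.
Qed.

(** Distinct blocks over one edge would contain opposite points, which only the
block {p, -p} does. *)
Lemma endpoints_inj : {in P &, injective (@endpoints R n)}.
Proof.
move=> x y Px Py exy.
have [i [j [ij Cij xij xE]]] := blockP Px.
have [u [v [uv Cuv yuv yE]]] := blockP Py.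
rewrite (endpoints_block Px ij xij) (endpoints_block Py uv yuv) in exy.
rewrite xE yE -exy; case: ifPn => // nk.
move/eqP: exy; rewrite set2_eq => /orP[] /andP[/eqP ei /eqP ej]; rewrite ei ej //.
rewrite ei ej in nk Cij.
by rewrite (graded_opposite gC Cij Cuv) eqxx in nk.
Qed.

Lemma cell_map_endpoints X : X `<=` P -> cell_map X = @endpoints R n @` X.
Proof.
move=> /fsubsetP XP; apply/fsetP=> s; apply/edges_ofP/imfsetP => /=.
  case=> i [j [ij /bigfcupP[x /andP[Xx _] xij] ->]]; exists x => //.
  by rewrite (endpoints_block (XP x Xx) ij xij).
case=> x Xx ->; have [i [j [ij _ xij _]]] := blockP (XP x Xx).
exists i, j; rewrite (endpoints_block (XP x Xx) ij xij); split=> //.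
by apply/bigfcupP; exists x; rewrite ?Xx.
Qed.

Lemma fcover_affine_ground : fcover P = C.
Proof.
have [k12 arcC _ _] := gC.
apply/fsetP=> y; apply/bigfcupP/idP => [[x /andP[Px _]]|Cy].
  by apply/fsubsetP/block_sub.
have [/orP yK|] := boolP ((y == arc_pt R k1 k2) || (y == - arc_pt R k1 k2)).
  exists K; last by rewrite in_fset2; apply/orP.
  by rewrite andbT in_fsetU in_fset1 eqxx orbT.
rewrite negb_or => yNK; exists [fset y]; last exact: fset11.
rewrite andbT in_fsetU; apply/orP; left; apply/imfsetP; exists y => //=.
by rewrite inE /= Cy.
Qed.

(** A union of blocks contains p exactly when it contains -p, which is what
allows the weight of the contracted edge to be split between them. *)
Lemma graphic_indep_cell_map X : X `<=` P ->
  graphic_indep (cell_map X) <-> affine_indep X.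
Proof.
move=> /fsubsetP XP.
have XC : fcover X `<=` C.
  apply/fsubsetP=> y /bigfcupP[x /andP[/XP Px _]].
  exact/fsubsetP/block_sub.
have [k12 _ _ _] := gC.
have XK : (arc_pt R k1 k2 \in fcover X) = (arc_pt R k2 k1 \in fcover X).
  have k21 : k2 != k1 by rewrite eq_sym.
  apply/bigfcupP/bigfcupP => -[x /andP[/[dup] Xx /XP Px _] xk]; exists x;
    rewrite ?Xx // (mem_block Px _ xk) //.
    by rewrite eqxx in_fset2 arc_ptN eqxx orbT.
  by rewrite setUC eqxx in_fset2 eqxx.
split; first exact: (graphic_indep_affinely_independent gC XC XK).
exact: (affinely_independent_graphic_indep gC XC XK).
Qed.

End Blocks.

Theorem proposition4 (R : realType) (n : nat) (e : rel 'I_n.+1)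
    (e_sym : symmetric e) (e_irr : irreflexive e)
    (e_conn : forall x y : 'I_n.+1, connect e x y)
    (k1 k2 : 'I_n.+1) (e_k : e k1 k2)
    (C : {fset 'rV[R]_n}) (cell_C : contraction_cell e k1 k2 C)
    (X : {fset {fset 'rV[R]_n}}) (sub_X : X `<=` affine_ground k1 k2 C) :
  let P := affine_ground k1 k2 C in
  let E := graphic_ground C in
  let I := @affine_indep R n in
  let J := @graphic_indep 'I_n.+1 in
  let f := @cell_map R n in
  f X `<=` E /\
  [/\ basis_set E J (f X) <-> basis_set P I X,
      circuit_set E J (f X) <-> circuit_set P I X,
      dependent_set E J (f X) <-> dependent_set P I X
    & rank_set E J (f X) = rank_set P I X].
Proof.
move=> P E I J f.
have [Cp Cq [g gC]] := contraction_cell_graded e_sym e_irr e_k cell_C.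
have fE Y : Y `<=` P -> f Y = @endpoints R n @` Y.
  exact: cell_map_endpoints Cp gC Y.
have EE : E = @endpoints R n @` P.
  by rewrite -fE ?fsubset_refl // /f /cell_map (fcover_affine_ground Cp Cq gC).
have inj : {in P &, injective (@endpoints R n)} := endpoints_inj Cp gC.
have indepE Y : Y `<=` P -> J (@endpoints R n @` Y) <-> I Y.
  by move=> YP; rewrite -fE //; apply: graphic_indep_cell_map Cp Cq gC Y YP.
rewrite fE // EE; split; first exact: imfset_subset.
split; [exact: basis_set_imfset | exact: circuit_set_imfset
       | exact: dependent_set_imfset | exact: rank_set_imfset].
Qed.
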